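(* Let $Y\in\mathbb{R}^{n\times p}$, $\mathcal M=\{u\in\mathbb{R}^n:\|u\|=1\}$, and suppose that the optimal value of the problem $\min\{\|Y^Tx\|_1:x\in\mathcal M\}$ is not $0$. Let $\{x^k\}$ be the sequence generated by $\mathsf{ManPPA}_{\mathsf{rw}}$ with $\phi(s)=s$ for solving this problem. Then $\{x^k\}$ converges linearly to a stationary point of this problem; that is, there exist a stationary point $x^*$, $c>0$ and $q\in[0,1)$ such that $\|x^k-x^*\|\le c\,q^k$ for all $k$.
   Context: $\|\cdot\|$ is the Euclidean norm, $\|\cdot\|_1$ the $\ell_1$ norm, $\|\cdot\|_2$ the operator norm of a matrix, $\delta_{\mathcal M}$ the indicator function of $\mathcal M$ ($0$ on $\mathcal M$, $+\infty$ elsewhere). Algorithm ($\mathsf{ManPPA}_{\mathsf{rw}}$ with $\phi(s)=s$). Let $L_f=\sqrt p\,\|Y\|_2$. Choose $x^0\in\mathcal M$ and $t\in(0,2/L_f)$. For $k=0,1,2,\dots$: let $d^k$ be the (unique) minimizer of $d\mapsto\|Y^T(x^k+d)\|_1+\frac1{2t}\|d\|^2$ over $\{d\in\mathbb{R}^n:\langle x^k,d\rangle=0\}$; set $x^{k+1}=\frac{x^k+d^k}{\|x^k+d^k\|}$. Stationary points. For a proper closed $h:\mathbb{R}^n\to(-\infty,\infty]$ and $\bar x\in\mathrm{dom}\,h$, the regular subdifferential is $\widehat\partial h(\bar x)=\{v:\liminf_{x\to\bar x,x\ne\bar x}\frac{h(x)-h(\bar x)-\langle v,x-\bar x\rangle}{\|x-\bar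 x\|}\ge0\}$ and the limiting subdifferential is $\partial h(\bar x)=\{v:\exists x^k\to\bar x,\ h(x^k)\to h(\bar x),\ v^k\in\widehat\partial h(x^k),\ v^k\to v\}$; both are empty outside $\mathrm{dom}\,h$. A point $x^*$ is a stationary point of $\min\{\|Y^Tx\|_1:x\in\mathcal M\}$ if $0\in\partial\widehat F(x^* )$, where $\widehat F(x)=\|Y^Tx\|_1+\delta_{\mathcal M}(x)$. *)

(* Defs.v *)
From HB Require Import structures.
From mathcomp Require Export all_boot all_order all_algebra.
From mathcomp Require Export all_classical all_reals all_analysis.
Export Order.TTheory GRing.Theory Num.Theory.
Export numFieldNormedType.Exports.

Set Implicit Arguments.
Unset Strict Implicit.
Unset Printing Implicit Defensive.

Local Open Scope classical_set_scope.
Local Open Scope ring_scope.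

Section EuclideanSpace.
Context {R : realType}.

Definition dotv n (u v : 'cV[R]_n) : R := \sum_i u i 0 * v i 0.

(* The library norm `|u| on 'cV[R]_n is the sup norm; only its topology, which
   is the Euclidean one, is used below. *)
Definition norm2 n (u : 'cV[R]_n) : R := Num.sqrt (dotv u u).

Definition norm1 n (u : 'cV[R]_n) : R := \sum_i `|u i 0|.

Definition opnorm2 m n (A : 'M[R]_(m, n)) : R :=
  sup [set norm2 (A *m u) | u in [set u : 'cV[R]_n | norm2 u <= 1]].

Definition sphere2 n : set 'cV[R]_n := [set u | norm2 u = 1].

Definition is_argmin n (f : 'cV[R]_n -> R) (A : set 'cV[R]_n) (d : 'cV[R]_n) :=
  A d /\ forall d', A d' -> f d <= f d'.

End EuclideanSpace.

Arguments sphere2 {R} n.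

Section Subdifferentials.
Context {R : realType} {n : nat}.
Local Open Scope ereal_scope.
Implicit Types (h : 'cV[R]_n -> \bar R) (xbar v : 'cV[R]_n).

Definition regular_subdiff h xbar : set 'cV[R]_n := [set v |
  h xbar < +oo /\
  0 <= limf_einf
    (fun x => (h x - h xbar - (dotv v (x - xbar)%R)%:E)
              * ((norm2 (x - xbar)%R)^-1)%:E)
    xbar^'].

Definition limiting_subdiff h xbar : set 'cV[R]_n := [set v |
  h xbar < +oo /\
  exists (x_ v_ : nat -> 'cV[R]_n),
    [/\ x_ @ \oo --> xbar, h \o x_ @ \oo --> h xbar,
        (forall k, regular_subdiff h (x_ k) (v_ k)) & v_ @ \oo --> v]].

Definition set_indicator (A : set 'cV[R]_n) (x : 'cV[R]_n) : \bar R :=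
  if x \in A then 0 else +oo.

End Subdifferentials.

Section Problem.
Context {R : realType} {n p : nat} (Y : 'M[R]_(n, p)).

Definition objective (x : 'cV[R]_n) : R := norm1 (Y^T *m x).

Definition optimal_value : R := inf [set objective x | x in sphere2 n].

Definition Fhat (x : 'cV[R]_n) : \bar R :=
  ((objective x)%:E + set_indicator (sphere2 n) x)%E.

Definition stationary (x : 'cV[R]_n) : Prop := limiting_subdiff Fhat x 0.

Definition Lf : R := Num.sqrt p%:R * opnorm2 Y.

Definition manppa_subproblem (t : R) (x d : 'cV[R]_n) : Prop :=
  is_argmin (fun d => objective (x + d) + (2 * t)^-1 * norm2 d ^+ 2)
            [set d | dotv x d = 0] d.

Definition manppa_rw (t : R) (x : nat -> 'cV[R]_n) : Prop :=
  [/\ sphere2 n (x 0%N), 0 < t < 2 / Lf &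
      exists d : nat -> 'cV[R]_n, forall k,
        manppa_subproblem t (x k) (d k) /\
        x k.+1 = (norm2 (x k + d k))^-1 *: (x k + d k)].

End Problem.

(* Main.v *)
Require Import Defs.
From mathcomp Require Import ring lra.

(** The sequence is not merely linearly convergent: it is eventually constant,
    because the objective f is piecewise linear with finitely many pieces.

    Write w = x k + d k and D = |d k|^2, so that x k.+1 = w / |w| with
    |w|^2 = 1 + D.  Strong convexity of the subproblem gives the descent
    f (x k.+1) + D / t <= f (x k) (iterate_descent); thus f (x k) decreases to
    a limit l >= 0 and its gaps tend to 0.

    Call a cell the set of all v for which Y^T v has a prescribed vector of
    signs; there are finitely many cells and f is linear on each.  If v is a
    unit vector in the cell of w, then moving from w in the direction - v stays
    in the cell for a short while, so f is differentiable at w along v in both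
    senses and the optimality of d k determines f v: it equals < v, y > for
    y = (f w + D / t) x k - d k / t.  By Cauchy-Schwarz and the descent,
    f v ^ 2 <= f (x k) ^ 2 + D / t ^ 2 (subproblem_cell_bound).  In other words,
    late in the run f is at most about l on the unit vectors of every cell
    being visited.

    By the pigeonhole principle some cell is visited infinitely often.  Take v
    to be an iterate in that cell and let k run through the later visits:
    the right-hand side tends to l ^ 2, hence f v <= l.  Since f (x k) decreases
    to l, it equals l from then on; the descent inequality forces d k = 0, and
    x k no longer moves (finite_termination).

    At the final point x the subproblem is solved by d = 0.  Rescaling a nearby
    unit vector z to the tangent hyperplane gives f z >= f x - C |z - x|^2
    (objective_quadratic_lower_bound), so that 0 is already a regular
    subgradient of f + indicator of the sphere at x. *)

Set Implicit Arguments.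
Unset Strict Implicit.
Unset Printing Implicit Defensive.

Local Open Scope classical_set_scope.
Local Open Scope ring_scope.

(** * The Euclidean inner product *)

Section InnerProduct.
Context {R : realType} {n : nat}.
Implicit Types (u v w : 'cV[R]_n) (a : R).

Lemma dotvC u v : dotv u v = dotv v u.
Proof. by apply: eq_bigr => i _; rewrite mulrC. Qed.

Lemma dotvDr u v w : dotv u (v + w) = dotv u v + dotv u w.
Proof. by rewrite -big_split; apply: eq_bigr => i _; rewrite mxE mulrDr. Qed.

Lemma dotvZr a u v : dotv u (a *: v) = a * dotv u v.
Proof. by rewrite mulr_sumr; apply: eq_bigr => i _; rewrite mxE mulrCA. Qed.

Lemma dotvDl u v w : dotv (u + v) w = dotv u w + dotv v w.
Proof. by rewrite dotvC dotvDr !(dotvC w). Qed.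

Lemma dotvZl a u v : dotv (a *: u) v = a * dotv u v.
Proof. by rewrite dotvC dotvZr dotvC. Qed.

Lemma dotvNr u v : dotv u (- v) = - dotv u v.
Proof. by rewrite -scaleN1r dotvZr mulN1r. Qed.

Lemma dotvNl u v : dotv (- u) v = - dotv u v.
Proof. by rewrite dotvC dotvNr dotvC. Qed.

Lemma dotv0 u : dotv 0 u = 0.
Proof. by rewrite -(scale0r 0) dotvZl mul0r. Qed.

Definition dotvE :=
  (dotvDl, dotvDr, dotvZl, dotvZr, dotvNl, dotvNr).

Lemma dotv_ge0 u : 0 <= dotv u u.
Proof. by apply: sumr_ge0 => i _; rewrite -expr2 sqr_ge0. Qed.

Lemma dotv_eq0 u : dotv u u = 0 -> u = 0.
Proof.
move=> /eqP; rewrite psumr_eq0; last by move=> i _; rewrite -expr2 sqr_ge0.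
move=> /allP u0; apply/colP => i; rewrite mxE; apply/eqP.
by have := u0 i (mem_index_enum i); rewrite -expr2 sqrf_eq0.
Qed.

Lemma sqr_norm2 u : norm2 u ^+ 2 = dotv u u.
Proof. by rewrite sqr_sqrtr// dotv_ge0. Qed.

Lemma norm2_ge0 u : 0 <= norm2 u.
Proof. exact: sqrtr_ge0. Qed.

Lemma norm2_eq0 u : norm2 u = 0 -> u = 0.
Proof. by move=> u0; apply: dotv_eq0; rewrite -sqr_norm2 u0 expr0n. Qed.

Lemma norm20 : norm2 (0 : 'cV[R]_n) = 0.
Proof. by rewrite /norm2 dotv0 sqrtr0. Qed.

Lemma sphere2P u : sphere2 n u <-> dotv u u = 1.
Proof.
split; first by rewrite -sqr_norm2 => ->; rewrite expr1n.
by rewrite /sphere2/= /norm2 => ->; rewrite sqrtr1.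
Qed.

Lemma cauchy_schwarz_unit u v : dotv u u = 1 -> dotv u v ^+ 2 <= dotv v v.
Proof.
move=> u1; have := dotv_ge0 (v - dotv u v *: u).
by rewrite !dotvE u1 (dotvC v u); lra.
Qed.

(** Neighbourhoods of a column vector are balls for the sup norm; this bound
    turns them into Euclidean ones. *)
Lemma norm2_le_mx_norm u : norm2 u <= Num.sqrt n%:R * `|u|.
Proof.
rewrite -(ger0_norm (normr_ge0 u)) -sqrtr_sqr -sqrtrM ?ler0n// ler_sqrt;
  last first.
  by rewrite mulr_ge0// ?ler0n// sqr_ge0.
rewrite -[n in n%:R]card_ord mulr_natl -sumr_const ler_sum// => i _.
rewrite -expr2 -real_normK ?num_real// lerXn2r ?nnegrE//.
by rewrite [leRHS]mx_normrE; apply/bigmax_geP; right; exists (i, 0).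
Qed.

End InnerProduct.

(** * The objective and its cells of linearity *)

Section Objective.
Context {R : realType} {n p : nat} (Y : 'M[R]_(n, p)).
Implicit Types (u v w : 'cV[R]_n).

Lemma objective_ge0 u : 0 <= objective Y u.
Proof. by apply: sumr_ge0. Qed.

Lemma objectiveZ a u : 0 <= a -> objective Y (a *: u) = a * objective Y u.
Proof.
move=> a0; rewrite mulr_sumr; apply: eq_bigr => i _.
by rewrite -scalemxAr mxE normrM ger0_norm.
Qed.

Lemma ler_objectiveD u v : objective Y (u + v) <= objective Y u + objective Y v.
Proof.
rewrite -big_split ler_sum// => i _.
by rewrite mulmxDr mxE ler_normD.
Qed.

(** The label of the cell containing u.  It takes values in a finite type, as the
    pigeonhole argument requires, which Num.sg with values in R does not. *)
Definition signs u : {ffun 'I_p -> bool * bool} :=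
  [ffun i => (0 < (Y^T *m u) i 0, (Y^T *m u) i 0 < 0)].

Lemma signsZ a u : 0 < a -> signs (a *: u) = signs u.
Proof.
move=> a0; apply/ffunP => i.
by rewrite !ffunE -scalemxAr mxE pmulr_rgt0// pmulr_rlt0.
Qed.

(** Within a cell f is linear, and along e |-> (1 + e * c) u - e v one stays in
    the cell of u for small e: a nonzero coordinate of Y^T u keeps its sign,
    and a zero one stays zero because that of Y^T v vanishes as well.  The
    forward direction u + e v would need no smallness; it is the backward one
    that bounds f v from above.  The multiple of u is there to keep the inner
    product with the current iterate constant. *)
Lemma objective_retreat c u v : signs u = signs v ->
  \forall e \near 0^'+, objective Y ((1 + e * c) *: u - e *: v) =
                       (1 + e * c) * objective Y u - e * objective Y v.
Proof.
move=> uv; pose a i : R := (Y^T *m u) i 0; pose b i : R := (Y^T *m v) i 0.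
have sab i : [/\ (0 < a i) = (0 < b i) & (a i < 0) = (b i < 0)].
  by move/ffunP: uv => /(_ i); rewrite !ffunE => -[].
have : \forall e \near 0^'+, forall i, e * (`|b i| - c * `|a i|) <= `|a i|.
  apply: filter_forall => i; have [a0|a0] := eqVneq (a i) 0.
    have b0 : b i = 0.
      have [+ +] := sab i; rewrite a0 ltxx => b_le0 b_ge0.
      by apply/eqP; rewrite eq_le !leNgt -b_le0 -b_ge0.
    by near=> e; rewrite a0 b0 normr0 !mulr0 subr0 mulr0.
  have ai0 : 0 < `|a i| by rewrite normr_gt0.
  set s := _ - _; near=> e; have e0 : 0 < e by near: e; exact: nbhs_right_gt.
  have : e < `|a i| / (`|s| + 1).
    by near: e; apply: nbhs_right_lt; rewrite divr_gt0// ltr_wpDl.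
  rewrite ltr_pdivlMr; last by rewrite ltr_wpDl.
  have : e * s <= e * `|s| by rewrite ler_pM2l// ler_norm.
  by lra.
apply: filterS => e He; rewrite !mulr_sumr -sumrB; apply: eq_bigr => i _.
have -> : (Y^T *m ((1 + e * c) *: u - e *: v)) i 0 =
          (1 + e * c) * a i - e * b i.
  rewrite mulmxBr -!scalemxAr /a /b.
  by move: (Y^T *m u) (Y^T *m v) => ? ?; rewrite !mxE.
rewrite -/(a i) -/(b i); move: (He i) (sab i).
by have [] := ltrgt0P (a i); have [] := ltrgt0P (b i) => b0 a0 le []// _ _;
   rewrite ?a0 ?b0 ?mulr0 ?subr0 ?normr0//;
   first [rewrite ger0_norm; lra | rewrite ler0_norm; lra].
Unshelve. all: by end_near.
Qed.

End Objective.

(** * One step of the algorithm *)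

Section Step.
Context {R : realType} {n p : nat} (Y : 'M[R]_(n, p)) (t : R) (x d : 'cV[R]_n).
Hypotheses (t_gt0 : 0 < t) (x_unit : dotv x x = 1).
Hypothesis (dP : manppa_subproblem Y t x d).
Local Notation f := (objective Y).

Lemma subproblem_orth : dotv x d = 0. Proof. by case: dP. Qed.

(** The directional derivative of the subproblem's objective at its minimizer is
    nonnegative.  The slope s of f need only be an upper bound, which lets the
    same lemma serve a convexity estimate and an exact expansion. *)
Lemma subproblem_first_order (g : 'cV[R]_n) (s : R) : dotv x g = 0 ->
  (\forall e \near 0^'+, f (x + d + e *: g) <= f (x + d) + e * s) ->
  0 <= s + dotv d g / t.
Proof.
move=> xg fs; rewrite leNgt; apply/negP => s_lt0.
set m := s + _ in s_lt0; set b := dotv g g / (2 * t).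
have b_ge0 : 0 <= b by rewrite divr_ge0 ?dotv_ge0// mulr_ge0// ltW.
near (0 : R)^'+ => e.
have e0 : 0 < e by near: e; exact: nbhs_right_gt.
have : e < - m / (b + 1).
  by near: e; apply: nbhs_right_lt; rewrite divr_gt0 ?oppr_gt0// ltr_wpDl.
rewrite ltr_pdivlMr; last by rewrite ltr_wpDl.
move=> eb.
have fe : f (x + d + e *: g) <= f (x + d) + e * s by near: e.
have [_ /(_ (d + e *: g))] := dP.
rewrite /= !sqr_norm2 addrA !dotvE subproblem_orth xg (dotvC g d).
move=> /(_ _) min; have {min} := min ltac:(by rewrite mulr0 addr0).
have -> : (2 * t)^-1 *
    (dotv d d + e * dotv d g + (e * (dotv d g) + e * (e * dotv g g))) =
    (2 * t)^-1 * dotv d d + e * (m - s) + e * (e * b).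
  by rewrite /m /b; field; rewrite gt_eqF.
have : e * (m + e * b) < 0 by rewrite pmulr_rlt0//; lra.
by move: fe; lra.
Unshelve. all: by end_near.
Qed.

(** First-order condition in the direction - d, the slope of f towards x being at
    most f x - f (x + d) by convexity. *)
Lemma subproblem_descent : f (x + d) + dotv d d / t <= f x.
Proof.
have := @subproblem_first_order (- d) (f x - f (x + d)).
rewrite dotvNr subproblem_orth oppr0 dotvNr mulNr => /(_ erefl) H.
suff : 0 <= f x - f (x + d) - dotv d d / t by lra.
apply: H; near=> e.
have e0 : 0 < e by near: e; exact: nbhs_right_gt.
have e1 : e < 1 by near: e; exact: nbhs_right_lt.
have -> : x + d + e *: - d = (1 - e) *: (x + d) + e *: x.
  by rewrite scalerBl scalerN scale1r scalerDr opprD addrA addrAC subrK.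
rewrite (le_trans (ler_objectiveD _ _ _))// !objectiveZ; lra.
Unshelve. all: by end_near.
Qed.

Lemma dotv_step : dotv (x + d) (x + d) = 1 + dotv d d.
Proof. by rewrite !dotvE x_unit (dotvC d x) subproblem_orth; ring. Qed.

Lemma norm2_step_ge1 : 1 <= norm2 (x + d).
Proof. by rewrite -sqrtr1 ler_wsqrtr// dotv_step lerDl dotv_ge0. Qed.

(** The key estimate: after a short step, f exceeds f x only slightly on the unit
    vectors of the cell reached.  The first-order condition in the direction
    c (x + d) - v, with c = < x, v > making it tangent, shows that f v is at
    most the inner product of v with the subgradient y below, whose norm is
    controlled by the descent inequality. *)
Lemma subproblem_cell_bound (v : 'cV[R]_n) :
    dotv v v = 1 -> signs Y (x + d) = signs Y v ->
  f v ^+ 2 <= f x ^+ 2 + dotv d d / t ^+ 2.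
Proof.
move=> v1 sv; set w := x + d; set c := dotv x v.
(* The element y of the subdifferential of f at w dictated by optimality. *)
pose y := (f w + dotv d d / t) *: x - t^-1 *: d.
have fvy : f v <= dotv v y.
  have : 0 <= c * f w - f v + dotv d (c *: w - v) / t.
    apply: subproblem_first_order.
      by rewrite !dotvE x_unit subproblem_orth /c; ring.
    apply: filterS (objective_retreat c sv) => e fe.
    have -> : x + d + e *: (c *: w - v) = (1 + e * c) *: w - e *: v.
      by rewrite scalerBr scalerA scalerDl scale1r addrA.
    by rewrite fe; lra.
  rewrite !dotvE (dotvC d x) subproblem_orth (dotvC v x) (dotvC v d) -/c; lra.
have -> : f v ^+ 2 = `|f v| ^+ 2 by rewrite real_normK// num_real.
apply: (@le_trans _ _ (dotv v y ^+ 2)).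
  rewrite lerXn2r ?nnegrE ?normr_ge0 ?(le_trans (objective_ge0 Y v))//.
  by rewrite ger0_norm// objective_ge0.
apply: (le_trans (cauchy_schwarz_unit y v1)).
have -> : dotv y y = (f w + dotv d d / t) ^+ 2 + dotv d d / t ^+ 2.
  rewrite !dotvE x_unit (dotvC d x) subproblem_orth; field.
  by rewrite gt_eqF.
rewrite lerD2r lerXn2r ?nnegrE ?objective_ge0 ?subproblem_descent//.
by rewrite addr_ge0 ?objective_ge0// divr_ge0 ?dotv_ge0// ltW.
Qed.

Lemma objective_step_le : f ((norm2 (x + d))^-1 *: (x + d)) <= f (x + d).
Proof.
have w1 := norm2_step_ge1; have w0 : 0 < norm2 (x + d) by apply: lt_le_trans w1.
rewrite objectiveZ ?invr_ge0 ?norm2_ge0//.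
by rewrite ler_piMl ?objective_ge0// invf_le1.
Qed.

Lemma step_unit (x' := (norm2 (x + d))^-1 *: (x + d)) : dotv x' x' = 1.
Proof.
have w1 := norm2_step_ge1; have w0 : 0 < norm2 (x + d) by apply: lt_le_trans w1.
by rewrite /x' dotvZl dotvZr -sqr_norm2; field; rewrite gt_eqF.
Qed.

End Step.

(** * Finite termination *)

Lemma frequent_value (T : finType) (s : nat -> T) :
  exists k : T, forall N : nat, exists2 j, (N <= j)%N & s j = k.
Proof.
apply: contrapT => /forallNP nofreq.
have /choice[N NP] : forall k : T, exists N : nat,
    forall j, (N <= j)%N -> s j <> k.
  move=> k; have /existsNP[N NP] := nofreq k; exists N => j Nj sj.
  by apply: NP; exists j.
apply: (NP (s (\max_k N k)) (\max_k N k)) => //.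
exact: leq_bigmax.
Qed.

Section Convergence.
Context {R : realType} {n p : nat} (Y : 'M[R]_(n, p)) (t : R).
Variables (x d : nat -> 'cV[R]_n).
Hypotheses (t_gt0 : 0 < t) (x0_unit : dotv (x 0%N) (x 0%N) = 1).
Hypothesis dP : forall k, manppa_subproblem Y t (x k) (d k).
Hypothesis xS : forall k, x k.+1 = (norm2 (x k + d k))^-1 *: (x k + d k).
Local Notation f := (objective Y).

Lemma iterate_unit k : dotv (x k) (x k) = 1.
Proof. by elim: k => // k IH; rewrite xS (step_unit IH (dP k)). Qed.

Lemma iterate_descent k : f (x k.+1) + dotv (d k) (d k) / t <= f (x k).
Proof.
apply: le_trans (subproblem_descent t_gt0 (dP k)).
by rewrite lerD2r xS (objective_step_le (iterate_unit k) (dP k)).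
Qed.

Lemma objective_nonincreasing : nonincreasing_seq (f \o x).
Proof.
apply/nonincreasing_seqP => k; apply: le_trans (iterate_descent k).
by rewrite lerDl divr_ge0 ?dotv_ge0// ltW.
Qed.

Lemma objective_gap_cvg0 : f (x k) - f (x k.+1) @[k --> \oo] --> 0.
Proof.
have /cvg_ex[l fl] : cvgn (f \o x).
  apply: nonincreasing_is_cvgn; first exact: objective_nonincreasing.
  by exists 0 => _ [k _ <-]; exact: objective_ge0.
rewrite -(subrr l); apply: cvgB => //.
by move: fl; rewrite -cvg_shiftS.
Qed.

(** Let x K lie in a cell visited infinitely often.  Each later visit
    bounds f (x K) by later values of f, up to an error that the vanishing gaps
    make arbitrarily small. *)
Lemma objective_eventually_constant : exists K, forall j, (K <= j)%N ->
  f (x j) = f (x K).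
Proof.
have [k kP] := frequent_value (fun j => signs Y (x j + d j)).
have [i _ si] := kP 0%N; exists i.+1 => j ij.
apply/eqP; rewrite eq_le objective_nonincreasing//=.
rewrite -(@ler_pXn2r _ 2) ?nnegrE ?objective_ge0//.
apply/ler_addgt0Pr => e e0.
have et : 0 < e * t by rewrite mulr_gt0.
have /cvgrPdist_lt/(_ _ et)[N _ NP] := objective_gap_cvg0.
have [m] := kP (maxn N j); rewrite geq_max => /andP[Nm jm] sm.
have wi0 : 0 < (norm2 (x i + d i))^-1.
  rewrite invr_gt0 (lt_le_trans ltr01)//.
  exact: norm2_step_ge1 (iterate_unit i) (dP i).
have sim : signs Y (x m + d m) = signs Y (x i.+1).
  by rewrite xS signsZ// si sm.
have := subproblem_cell_bound t_gt0 (iterate_unit m) (dP m)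
  (iterate_unit i.+1) sim.
move=> /le_trans; apply; apply: lerD.
  by rewrite ler_pXn2r ?nnegrE ?objective_ge0// objective_nonincreasing.
have := NP m Nm; rewrite sub0r normrN => /(le_lt_trans (ler_norm _)) gap.
have Dm : dotv (d m) (d m) / t <= e * t by have := iterate_descent m; lra.
by rewrite expr2 invfM mulrA ler_pdivrMr.
Qed.

Lemma null_step k : f (x k.+1) = f (x k) -> d k = 0.
Proof.
move=> fk; apply: dotv_eq0; apply/eqP; rewrite eq_le dotv_ge0 andbT.
have : dotv (d k) (d k) / t <= 0 by have := iterate_descent k; lra.
by rewrite ler_pdivrMr// mul0r.
Qed.

Lemma finite_termination : exists2 K, d K = 0 & forall j, (K <= j)%N -> x j = x K.
Proof.
have [K KP] := objective_eventually_constant.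
have d0 j : (K <= j)%N -> d j = 0.
  by move=> Kj; apply: null_step; rewrite !KP// leqW.
exists K; first exact: d0.
elim=> [|j IH]; first by rewrite leqn0 => /eqP ->.
rewrite leq_eqVlt => /predU1P[->//|/ltnSE Kj]; rewrite -(IH Kj) xS d0// addr0.
by have /sphere2P -> := iterate_unit j; rewrite invr1 scale1r.
Qed.

End Convergence.

(** * Stationarity of the final point *)

Section Stationarity.
Context {R : realType} {n p : nat} (Y : 'M[R]_(n, p)) (t : R) (x : 'cV[R]_n).
Hypotheses (t_gt0 : 0 < t) (x_unit : dotv x x = 1).
Hypothesis xP : manppa_subproblem Y t x 0.
Local Notation f := (objective Y).

(** With a = < x, z >, the point z / a lies on the tangent hyperplane of the
    sphere at x, at squared distance a^-2 - 1 from x, so optimality of d = 0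
    bounds f z = a f (z / a) from below; the loss is of order
    1 - a = |z - x|^2 / 2. *)
Lemma objective_quadratic_lower_bound
    (C := f x / 2 + 3 / (4 * t)) (z : 'cV[R]_n) :
    dotv z z = 1 -> norm2 (z - x) <= 1 ->
  f x - C * norm2 (z - x) ^+ 2 <= f z.
Proof.
move=> z1 zx; set a := dotv x z.
have Na : norm2 (z - x) ^+ 2 = 2 - 2 * a.
  by rewrite sqr_norm2 !dotvE z1 x_unit (dotvC z x) /a; ring.
(* z is within distance 1 of x, so a is bounded away from 0. *)
have a2 : 1 / 2 <= a.
  have : norm2 (z - x) ^+ 2 <= 1 by rewrite expr_le1 ?norm2_ge0.
  by lra.
have a1 : a <= 1 by have := sqr_ge0 (norm2 (z - x)); rewrite Na; lra.
have a0 : 0 < a by lra.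
have fz : a * f x <= f z + (1 - a) * (1 + a) / a / (2 * t).
  have [_ /(_ (a^-1 *: z - x))] := xP.
  rewrite /= !sqr_norm2 addr0 dotv0 !dotvE z1 x_unit (dotvC z x) -/a.
  move=> /(_ _) min; have {min} := min ltac:(by rewrite mulVf ?gt_eqF// subrr).
  rewrite addrCA subrr addr0 objectiveZ ?invr_ge0; last exact: ltW.
  rewrite mulr0 addr0 -(ler_pM2l a0) => /le_trans; apply; rewrite le_eqVlt.
  by apply/orP; left; apply/eqP; field; rewrite !gt_eqF.
rewrite Na.
have : (1 - a) * (1 + a) / a / (2 * t) <= (1 - a) * 3 / (2 * t).
  rewrite ler_pM2r ?invr_gt0 ?mulr_gt0// -!mulrA ler_wpM2l ?subr_ge0//.
  by rewrite ler_pdivrMr//; lra.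
have -> : (1 - a) * 3 / (2 * t) = (1 - a) * (3 / (2 * t)) by rewrite mulrA.
have -> : C = (f x + 3 / (2 * t)) / 2 by rewrite /C; field; rewrite gt_eqF.
by move: fz; lra.
Qed.

(** The quadratic bound makes the difference quotient at z at least - C |z - x|,
    which is above - e once |z - x| <= e / (C + 1).  Off the sphere the quotient
    is infinite.  Constant sequences then witness the limiting subgradient. *)
Lemma stationary_of_null_step : stationary Y x.
Proof.
have FxE : Fhat Y x = (f x)%:E.
  rewrite /Fhat /set_indicator ifT ?adde0// inE; exact/sphere2P.
split; first by rewrite FxE ltry.
exists (fun=> x), (fun=> 0); split;
  [exact: cvg_cst|exact: cvg_cst| |exact: cvg_cst].
move=> _; split; first by rewrite FxE ltry.
rewrite limf_einfE FxE; apply/lee_subgt0Pr => e e0; rewrite sub0e.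
pose C := f x / 2 + 3 / (4 * t).
have C0 : 0 <= C by rewrite addr_ge0 ?divr_ge0 ?objective_ge0 ?mulr_ge0// ltW.
pose r := Num.min 1 (e / (C + 1)).
have r0 : 0 < r by rewrite lt_min ltr01 divr_gt0// ltr_wpDl.
pose s := r / (Num.sqrt n%:R + 1).
have s0 : 0 < s by rewrite divr_gt0// ltr_wpDl// sqrtr_ge0.
apply: le_trans; last first.
  apply: ereal_sup_ubound.
  exists [set z | norm2 (z - x) <= r /\ z != x]; last reflexivity.
  apply/nbhs_ballP; exists s => //= z; rewrite -ball_normE /= distrC => zx zne.
  split => //; apply: (le_trans (norm2_le_mx_norm _)).
  have : `|z - x| * (Num.sqrt n%:R + 1) <= r.
    by rewrite -ler_pdivlMr ?ltr_wpDl ?sqrtr_ge0// ltW.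
  by have := normr_ge0 (z - x); lra.
apply: le_ereal_inf_tmp => _ [z [zr zx] <-].
have N0 : 0 < norm2 (z - x).
  rewrite lt_def norm2_ge0 andbT; apply: contra_neq zx => /norm2_eq0 /eqP.
  by rewrite subr_eq0 => /eqP.
rewrite dotv0 sube0 /Fhat /set_indicator; case: ifPn => [|_].
  rewrite inE => /sphere2P z1; rewrite adde0 -EFinB -EFinM -EFinN lee_fin.
  rewrite ler_pdivlMr//.
  move: zr; rewrite le_min => /andP[zr1]; rewrite ler_pdivlMr ?ltr_wpDl// => zre.
  have := objective_quadratic_lower_bound z1 zr1; rewrite -/C.
  have : norm2 (z - x) * (norm2 (z - x) * (C + 1)) <= norm2 (z - x) * e.
    by rewrite ler_pM2l.
  by have := sqr_ge0 (norm2 (z - x)); lra.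
by rewrite addey// -EFinN addye// mulyr gtr0_sg ?invr_gt0// mul1e leey.
Qed.

End Stationarity.

(** * Linear convergence *)

Lemma geometric_bound_of_eventually_zero (R : realType) (u : nat -> R) (K : nat) :
    (forall k, 0 <= u k) -> (forall k, (K <= k)%N -> u k = 0) ->
  exists2 c, 0 < c & forall k, u k <= c * (1 / 2) ^+ k.
Proof.
move=> u0 uK; pose c := 1 + \sum_(k < K) u k * 2 ^+ k.
have cge0 : 0 <= \sum_(k < K) u k * 2 ^+ k.
  by apply: sumr_ge0 => k _; rewrite mulr_ge0 ?exprn_ge0.
exists c => [|k]; first by rewrite ltr_pwDl.
have [Kk|kK] := leqP K k.
  by rewrite uK// mulr_ge0 ?exprn_ge0 ?addr_ge0// divr_ge0.
rewrite div1r exprVn ler_pdivlMr ?exprn_gt0//.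
rewrite /c (bigD1 (Ordinal kK))//= addrCA lerDl addr_ge0// sumr_ge0// => i _.
by rewrite mulr_ge0 ?exprn_ge0.
Qed.

Theorem theorem4p4 (R : realType) (n p : nat) (Y : 'M[R]_(n, p))
    (hopt : optimal_value Y <> 0)
    (t : R) (x : nat -> 'cV[R]_n) (hx : manppa_rw Y t x) :
  exists (xstar : 'cV[R]_n) (c q : R),
    [/\ stationary Y xstar, 0 < c, 0 <= q < 1 &
        forall k : nat, norm2 (x k - xstar) <= c * q ^+ k].
Proof.
case: hx => /sphere2P x0_unit /andP[t_gt0 _] [d stepP].
have dP k := (stepP k).1; have xS k := (stepP k).2.
have [K dK xK] := finite_termination t_gt0 x0_unit dP xS.
have [|k Kk|c c0 xc] :=
    @geometric_bound_of_eventually_zero R (fun k => norm2 (x k - x K)) K.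
- by move=> k; exact: norm2_ge0.
- by rewrite xK// subrr norm20.
exists (x K), c, (1 / 2); split=> //; last by apply/andP; split; lra.
apply: (stationary_of_null_step t_gt0 (iterate_unit x0_unit dP xS K)).
by rewrite -dK.
Qed.
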